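(* Let $m$ be a positive integer, let $\alpha>0$, and let $\lambda$ be a nonzero real number. Let $X$ be a Poisson random variable with parameter $\frac{\alpha}{m}$, i.e. $P\{X=i\}=e^{-\alpha/m}\frac{(\alpha/m)^i}{i!}$ for $i=0,1,2,\dots$. Then for every integer $n\ge 0$, $$E[(mX+1)_{n,\lambda}]=D_{m,\lambda}(n,\alpha).$$
   Context: For real $x$ and nonzero real $\lambda$, the degenerate falling factorial is $(x)_{0,\lambda}=1$, $(x)_{n,\lambda}=x(x-\lambda)(x-2\lambda)\cdots(x-(n-1)\lambda)$ for $n\ge1$; the ordinary falling factorial is $(x)_0=1$, $(x)_k=x(x-1)\cdots(x-k+1)$. The degenerate Whitney numbers of the second kind $W_{m,\lambda}(n,k)$ are defined by $(mx+1)_{n,\lambda}=\sum_{k=0}^n W_{m,\lambda}(n,k)\,m^k(x)_k$ (as a polynomial identity in $x$), and the degenerate Dowling polynomials are $D_{m,\lambda}(n,x)=\sum_{k=0}^n W_{m,\lambda}(n,k)x^k$. Equivalently, $e_\lambda(t)\,e^{\frac{x}{m}(e_\lambda^m(t)-1)}=\sum_{n\ge0}D_{m,\lambda}(n,x)\frac{t^n}{n!}$, where $e_\lambda^x(t)=(1+\lambda t)^{x/\lambda}=\sum_{n\ge0}(x)_{n,\lambda}\frac{t^n}{n!}$ and $e_\lambda(t)=e_\lambda^1(t)$. *)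

(* Defs.v *)
From HB Require Import structures.
From mathcomp Require Import all_boot all_order all_algebra.
From mathcomp Require Import all_classical all_reals all_analysis.
From mathcomp Require Import ring.

Set Implicit Arguments.
Unset Strict Implicit.
Unset Printing Implicit Defensive.

Import Order.TTheory GRing.Theory Num.Theory.
Import numFieldNormedType.Exports.

Local Open Scope classical_set_scope.
Local Open Scope ring_scope.

(* Falling factorials over an arbitrary ring: they are used both at real
   numbers and at the polynomials 'X and m 'X + 1. *)
Definition dffact {A : pzRingType} (lam x : A) (n : nat) : A :=
  \prod_(i < n) (x - i%:R * lam).

Definition rffact {A : pzRingType} (x : A) (n : nat) : A :=
  \prod_(i < n) (x - i%:R).

(* w is the n-th row of the degenerate Whitney numbers of the second kind.
   The entries with k > n, which do not occur in the defining identity, are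
   set to 0, so that the row is uniquely determined when m > 0: see
   dwhitney2_rowP and dwhitney2_row_uniq below. *)
Definition dwhitney2_row {R : realType} (m : nat) (lam : R) (n : nat)
    (w : nat -> R) : Prop :=
  dffact lam%:P (m%:R *: 'X + 1) n
    = \sum_(k < n.+1) (w k * m%:R ^+ k) *: rffact ('X : {poly R}) k
  /\ forall k, (n < k)%N -> w k = 0.

Definition dwhitney2 {R : realType} (m : nat) (lam : R) (n : nat) : nat -> R :=
  get [set w | dwhitney2_row m lam n w].

Definition ddowling {R : realType} (m : nat) (lam : R) (n : nat) (x : R) : R :=
  \sum_(k < n.+1) dwhitney2 m lam n k * x ^+ k.

Lemma dwhitney2_row_exists {R : realType} (m : nat) (lam : R) (n : nat) :
  exists w, dwhitney2_row m lam n w.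
Proof.
elim: n => [|n [w [wE w0]]].
  exists (fun k => (k == 0)%:R); split; last by case.
  by rewrite big_ord1 /dffact /rffact !big_ord0 expr0 mulr1 scale1r.
pose w' k := (if k is k'.+1 then w k' else 0)
  + (m%:R * k%:R + 1 - n%:R * lam) * w k.
exists w'; split; last first.
  by case=> // k; rewrite ltnS /w' => nk; rewrite !w0 ?mulr0 ?addr0// ltnW.
rewrite {1}/dffact big_ord_recr /= -/(dffact _ _ _) wE mulr_suml.
have stepE k : (w k * m%:R ^+ k) *: rffact ('X : {poly R}) k
      * (m%:R *: 'X + 1 - n%:R * lam%:P) =
    (w k * m%:R ^+ k.+1) *: rffact ('X : {poly R}) k.+1
    + ((m%:R * k%:R + 1 - n%:R * lam) * w k * m%:R ^+ k) *: rffact 'X k.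
  rewrite {2}/rffact big_ord_recr /= -/(rffact _ _).
  rewrite -!mul_polyC !polyCM !polyCB !polyCD !polyCM !rmorphXn /= !polyC_natr.
  by rewrite exprS; ring.
rewrite (eq_bigr _ (fun (i : 'I_n.+1) _ => stepE i)).
rewrite big_split /=.
have -> : \sum_(k < n.+2) (w' k * m%:R ^+ k) *: rffact ('X : {poly R}) k =
    \sum_(k < n.+2) ((if nat_of_ord k is k'.+1 then w k' else 0) * m%:R ^+ k)
      *: rffact ('X : {poly R}) k
    + \sum_(k < n.+2) ((m%:R * k%:R + 1 - n%:R * lam) * w k * m%:R ^+ k)
      *: rffact ('X : {poly R}) k.
  by rewrite -big_split; apply: eq_bigr => k _; rewrite /w' mulrDl scalerDl.
congr (_ + _).
  by rewrite [RHS]big_ord_recl /= mul0r scale0r add0r; apply: eq_bigr.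
by rewrite [RHS]big_ord_recr /= (w0 n.+1)// mulr0 mul0r scale0r addr0.
Qed.

Lemma dwhitney2_rowP {R : realType} (m : nat) (lam : R) (n : nat) :
  dwhitney2_row m lam n (dwhitney2 m lam n).
Proof. exact: (getPex (dwhitney2_row_exists m lam n)). Qed.

Lemma dwhitney2_row_uniq {R : realType} (m : nat) (lam : R) (n : nat) w :
  (0 < m)%N -> dwhitney2_row m lam n w -> w = dwhitney2 m lam n.
Proof.
move=> m0 [wE w0]; have [vE v0] := dwhitney2_rowP m lam n.
set v := dwhitney2 m lam n in vE v0 *.
have sz k : rffact ('X : {poly R}) k \is monic /\ size (rffact ('X : {poly R}) k) = k.+1.
  split; rewrite /rffact.
    by apply: monic_prod => i _; rewrite -polyC_natr monicXsubC.
  under eq_bigr do rewrite -polyC_natr.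
  by rewrite size_prod_XsubC /index_enum -enumT size_enum_ord.
have {wE vE} : \sum_(k < n.+1) ((w k - v k) * m%:R ^+ k) *: rffact ('X : {poly R}) k = 0.
  transitivity (\sum_(k < n.+1) (w k * m%:R ^+ k) *: rffact ('X : {poly R}) k
    - \sum_(k < n.+1) (v k * m%:R ^+ k) *: rffact ('X : {poly R}) k).
    by rewrite -sumrB; apply: eq_bigr => k _; rewrite mulrBl scalerBl.
  by rewrite -wE -vE subrr.
move=> S0; apply/funext => k.
have [nk|kn] := ltnP n k; first by rewrite w0// v0.
suff H N : \sum_(k < N) ((w k - v k) * m%:R ^+ k) *: rffact ('X : {poly R}) k = 0 ->
    forall k, (k < N)%N -> w k = v k by exact: (H n.+1).
elim: N => [//|N IH]; rewrite big_ord_recr /= => SN.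
have wvN : w N = v N.
  have /(congr1 (fun p : {poly R} => p`_N)) := SN.
  rewrite coefD coef_sum big1 => [|i _]; last first.
    by rewrite coefZ nth_default ?mulr0// (sz i).2.
  have [/monicP + sN] := sz N; rewrite lead_coefE sN /= => lN.
  rewrite add0r coefZ lN mulr1 coef0 => /eqP.
  by rewrite mulf_eq0 subr_eq0 expf_eq0 pnatr_eq0 (gtn_eqF m0) andbF orbF => /eqP.
move=> j; rewrite ltnS leq_eqVlt => /predU1P[->//|]; apply: IH.
by move: SN; rewrite wvN subrr mul0r scale0r addr0.
Qed.

(* Main.v *)
(* The k-th factorial moment of a Poisson variable of parameter r is r ^ k.
   Taking expectations in the identity that defines the degenerate Whitney
   numbers, evaluated at X, turns m ^ k (X)_k into
   m ^ k (alpha / m) ^ k = alpha ^ k.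
   The random variable is real-valued and only its masses at the natural
   numbers are given: since these masses sum to 1, its expectations are series
   over the natural numbers, where the falling factorials are nonnegative. *)

Require Import Defs.
From HB Require Import structures.
From mathcomp Require Import all_boot all_order all_algebra.
From mathcomp Require Import all_classical all_reals all_analysis.
From mathcomp Require Import measurable_realfun.

Import Order.TTheory GRing.Theory Num.Theory.
Import numFieldNormedType.Exports.

Local Open Scope classical_set_scope.
Local Open Scope ring_scope.

Lemma rffact_nat (R : realType) (i k : nat) :
  rffact (i%:R : R) k = (i ^_ k)%:R.
Proof.
elim: k => [|k IH]; first by rewrite /rffact big_ord0 ffactn0.
rewrite /rffact big_ord_recr /= -/(rffact _ _) IH ffactnSr natrM.
(* For [i < k] the truncated difference [i - k] is not the real one, but both sides vanish because
   [i ^_ k = 0]. *)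
have [ki|ik] := leqP k i; first by rewrite natrB.
by rewrite ffact_small// !mul0r.
Qed.

Lemma horner_rffactX (R : realType) (x : R) (k : nat) :
  (rffact ('X : {poly R}) k).[x] = rffact x k.
Proof.
rewrite /rffact horner_prod; apply: eq_bigr => i _.
by rewrite -polyC_natr !hornerE.
Qed.

(** Evaluation at [x] is a ring morphism, so it carries the polynomial identity defining the Whitney
    row to real numbers. *)
Lemma dffact_dwhitney2 (R : realType) (m : nat) (lam x : R) (n : nat) :
  dffact lam (m%:R * x + 1) n =
  \sum_(k < n.+1) dwhitney2 m lam n k * m%:R ^+ k * rffact x k.
Proof.
have /(congr1 (horner^~ x)) := (dwhitney2_rowP m lam n).1.
rewrite horner_sum => wE.
transitivity (dffact lam%:P (m%:R *: 'X + 1) n).[x].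
  rewrite /dffact horner_prod; apply: eq_bigr => i _.
  by rewrite -polyC_natr !hornerE.
by rewrite wE; apply: eq_bigr => k _; rewrite hornerZ horner_rffactX.
Qed.

Lemma measurable_rffact (R : realType) (k : nat) :
  measurable_fun setT (fun x : R => rffact x k).
Proof.
by apply: measurable_prod => i _; exact: measurable_funB.
Qed.

Lemma sum_poisson_pmf (R : realType) (r : R) : 0 < r ->
  (\sum_(i <oo) (poisson_pmf r i)%:E = 1)%E.
Proof.
move=> r0; have : poisson_prob r 0 setT = 1%E by exact: probability_setT.
rewrite /poisson_prob r0 nneseries_esumT// => i.
by rewrite lee_fin poisson_pmf_ge0.
Qed.

Lemma ffact_poisson_pmf (R : realType) (r : R) (k i : nat) : 0 < r ->
  ((i + k) ^_ k)%:R * poisson_pmf r (i + k) = r ^+ k * poisson_pmf r i.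
Proof.
move=> r0; rewrite /poisson_pmf r0 !mulrA; congr (_ * _).
(* Writing [(i + k)!] as [(i + k) ^_ k * i!] lets the falling factorial cancel. *)
have := ffact_fact (leq_addl i k); rewrite addnK => <-.
rewrite natrM invfM exprD [r ^+ i * _]mulrC !mulrA.
rewrite [_ * r ^+ k]mulrC -!mulrA; congr (_ * _).
rewrite mulrCA; congr (_ * _); rewrite mulrA divff ?mul1r//.
by rewrite pnatr_eq0 -lt0n ffact_gt0 leq_addl.
Qed.

Lemma sum_ffact_poisson_pmf (R : realType) (r : R) (k : nat) : 0 < r ->
  (\sum_(i <oo) ((i ^_ k)%:R * poisson_pmf r i)%:E = (r ^+ k)%:E)%E.
Proof.
move=> r0.
have f0 i : (0 <= ((i ^_ k)%:R * poisson_pmf r i)%:E)%E.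
  by rewrite lee_fin mulr_ge0// poisson_pmf_ge0.
(* The terms with [i < k] vanish; shifting the others by [k] leaves [r ^+ k] times the total Poisson
   mass. *)
rewrite (nneseries_split 0 k)// add0n big_nat big1 => [|i /andP[_ ik]]; last first.
  by rewrite ffact_small// mul0r.
rewrite add0e -nneseries_addn//.
under eq_eseriesr do rewrite ffact_poisson_pmf// EFinM.
rewrite nneseriesZl => [|i _]; last by rewrite lee_fin poisson_pmf_ge0.
by rewrite sum_poisson_pmf// mule1.
Qed.

Section nat_valued.
Context {R : realType} {d : measure_display} {T : measurableType d}.
Context (P : probability T R) (X : {RV P >-> R}).

Let A (i : nat) : set T := [set t | X t = i%:R].

Let measurable_A i : measurable (A i).
Proof.
exact: (measurable_funPTI X (measurable_set1 i%:R)).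
Qed.

Let trivIset_A : trivIset setT A.
Proof.
apply/trivIsetP => i j _ _; apply: contraNeq => /set0P[t [/= Xi Xj]].
by rewrite -(eqr_nat R) -Xi Xj.
Qed.

(** The disjoint events [A i] carry all the mass, and [f (X t)] is constant on each. Nonnegativity
    is asked at naturals only, since [rffact x k] may be negative between them. *)
Lemma ge0_integral_nat_valued (f : R -> R) :
  (\sum_(i <oo) P [set t | X t = i%:R] = 1)%E ->
  measurable_fun setT f -> (forall i : nat, 0 <= f i%:R) ->
  (\int[P]_t (f (X t))%:E = \sum_(i <oo) (f i%:R)%:E * P [set t | X t = i%:R])%E.
Proof.
move=> PX mf f0; set U := \bigcup_i A i.
have mU : measurable U by exact: bigcup_measurable.
have PU : P U = 1%E by rewrite measure_semi_bigcup.
have mfX D : measurable_fun D (fun t => (f (X t))%:E).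
  by apply: measurable_funTS; apply/measurable_EFinP; exact: measurableT_comp.
(* Hence [X] is almost surely a natural number. *)
have PCU : P (~` U) = 0%E by rewrite probability_setC// PU subee.
have mCU : measurable (~` U) by exact: measurableC.
rewrite -(setUv U) integral_setU//; last by apply/disj_setPS; rewrite setICr.
rewrite [X in (_ + X)%E]null_set_integral//.
rewrite adde0 ge0_integral_bigcup//; last first.
  by move=> t [i _ /= ->]; rewrite lee_fin.
apply: eq_eseriesr => i _.
rewrite (eq_integral (cst (f i%:R)%:E)) ?integral_cst// => t.
by rewrite inE => /= ->.
Qed.

End nat_valued.

Section factorial_moment.
Context {R : realType} {d : measure_display} {T : measurableType d}.
Context (P : probability T R) (X : {RV P >-> R}) (r : R).
Hypothesis r0 : 0 < r.
Hypothesis PX : forall i : nat, P [set t | X t = i%:R] = (poisson_pmf r i)%:E.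

Let sumPX : (\sum_(i <oo) P [set t | X t = i%:R] = 1)%E.
Proof. by under eq_eseriesr do rewrite PX; exact: sum_poisson_pmf. Qed.

Lemma integral_rffact_poisson (k : nat) :
  (\int[P]_t (rffact (X t) k)%:E = (r ^+ k)%:E)%E.
Proof.
rewrite (ge0_integral_nat_valued P X (fun x => rffact x k))//.
- under eq_eseriesr do rewrite PX rffact_nat -EFinM.
  exact: sum_ffact_poisson_pmf.
- exact: measurable_rffact.
- by move=> i; rewrite rffact_nat.
Qed.

Lemma integrable_rffact_poisson (k : nat) :
  P.-integrable setT (fun t => (rffact (X t) k)%:E).
Proof.
have mX : measurable_fun setT (fun t => rffact (X t) k).
  exact: (measurableT_comp (measurable_rffact R k)).
apply/integrableP; split; first exact/measurable_EFinP.
(* The integral is that of the positive part minus that of the negative part, so its finite value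
   [r ^+ k] forces both to be finite. *)
by rewrite integral_fin_num_abs// integral_rffact_poisson.
Qed.

End factorial_moment.

Theorem theorem1 (R : realType) (m : nat) (alpha lam : R)
    (d : measure_display) (T : measurableType d) (P : probability T R)
    (X : {RV P >-> R}) (n : nat) :
  (0 < m)%N -> 0 < alpha -> lam != 0 ->
  (forall i : nat,
     P [set t | X t = i%:R] = (poisson_pmf (alpha / m%:R) i)%:E) ->
  'E_P[fun t => dffact lam (m%:R * X t + 1)%R n]%E = (ddowling m lam n alpha)%:E.
Proof.
move=> m0 alpha0 _ PX.
have mR0 : m%:R != 0 :> R by rewrite pnatr_eq0 -lt0n.
have r0 : 0 < alpha / m%:R by rewrite divr_gt0// ltr0n.
have intX := integrable_rffact_poisson P X _ r0 PX.
rewrite unlock; under eq_integral do rewrite dffact_dwhitney2 -sumEFin.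
rewrite integral_sum//; last first.
  move=> k; under eq_fun do rewrite EFinM.
  exact: integrableZl.
rewrite /ddowling -sumEFin; apply: eq_bigr => k _.
under eq_integral do rewrite EFinM.
rewrite integralZl// (integral_rffact_poisson P X _ r0 PX) -EFinM.
(* The powers merge into [(m * (alpha / m)) ^ k], which is [alpha ^ k] as [m] is nonzero. *)
by rewrite -mulrA -exprMn mulrCA divff ?mulr1.
Qed.
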